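(* Let $n$ be a positive integer. For every $k\in\{0,\ldots,n\}$, $$\#\Bigl\{\boldsymbol{\gamma}\in\Gamma_{n,n}:\widehat\rho_2(\boldsymbol{\gamma})\ge 1-\frac kn\Bigr\}=[x^n]\left(\frac{Q_{k+1}'(x)}{Q_k(x)}-\frac{Q_{k+2}'(x)}{Q_{k+1}(x)}\right).$$
   Context: $\Gamma_{n,n}$ is the set of sequences $\boldsymbol{\gamma}=(\gamma_1,\ldots,\gamma_{2n})\in\{0,1\}^{2n}$ with exactly $n$ zeros and $n$ ones. For $i\in\{0,\ldots,2n\}$ let $\widehat F_{0,\boldsymbol{\gamma}}(i)=\frac1n\#\{j\le i:\gamma_j=0\}$ and $\widehat F_{1,\boldsymbol{\gamma}}(i)=\frac1n\#\{j\le i:\gamma_j=1\}$. Write $g|_a^b=g(b)-g(a)$. For $0\le j_1\le j_2\le 2n$, with $j_0=0$, $j_3=2n$, let $$\widehat r_{\boldsymbol{\gamma}}(j_1,j_2)=\sum_{i=0}^2\min\{\widehat F_{0,\boldsymbol{\gamma}}|_{j_i}^{j_{i+1}},\widehat F_{1,\boldsymbol{\gamma}}|_{j_i}^{j_{i+1}}\},\qquad \widehat\rho_2(\boldsymbol{\gamma})=\min_{0\le j_1\le j_2\le 2n}\widehat r_{\boldsymbol{\gamma}}(j_1,j_2).$$ The polynomials $Q_i(x)$ are defined by $Q_0(x)=Q_1(x)=1$ and $Q_{i+2}(x)=Q_{i+1}(x)-xQ_i(x)$ for $i\ge 0$; $Q_i'(x)$ is the derivative. Each $Q_i(x)$ has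 constant coefficient $1$, so $1/Q_i(x)$ denotes its multiplicative inverse as a formal power series. $[x^n]Q(x)$ denotes the coefficient of $x^n$ in the formal power series $Q(x)$. *)

(* Defs.v *)
From HB Require Import structures.
From mathcomp Require Import all_boot all_order all_algebra.
Set Implicit Arguments.
Unset Strict Implicit.
Unset Printing Implicit Defensive.
Import Order.TTheory GRing.Theory Num.Theory.
Local Open Scope ring_scope.

(* The letters 0 and 1 are encoded as [false] and [true]. *)
Definition Gamma (n : nat) : {set (2 * n).-tuple bool} :=
  [set g : (2 * n).-tuple bool | (count_mem false g == n) && (count_mem true g == n)].

Definition Fhat (n : nat) (b : bool) (g : (2 * n).-tuple bool) (i : nat) : rat :=
  (count_mem b (take i g))%:R / n%:R.

Definition increment (F : nat -> rat) (a b : nat) : rat := F b - F a.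

Definition rhat (n : nat) (g : (2 * n).-tuple bool) (j1 j2 : nat) : rat :=
  let j := nth 0%N [:: 0; j1; j2; 2 * n]%N in
  \sum_(i < 3) Num.min (increment (Fhat false g) (j i) (j i.+1))
                       (increment (Fhat true g) (j i) (j i.+1)).

(* The default value [rhat g 0 0] of the iterated minimum is itself one of the
   values ranged over, so it does not affect the result; see [rho2P]. *)
Definition rho2 (n : nat) (g : (2 * n).-tuple bool) : rat :=
  \big[Num.min/rhat g 0 0]_(p : 'I_(2 * n).+1 * 'I_(2 * n).+1 | (p.1 <= p.2)%N)
     rhat g p.1 p.2.

Lemma rho2P (n : nat) (g : (2 * n).-tuple bool) :
  (exists j1 j2 : nat, (j1 <= j2 <= 2 * n)%N /\ rho2 g = rhat g j1 j2) /\
  (forall j1 j2 : nat, (j1 <= j2 <= 2 * n)%N -> rho2 g <= rhat g j1 j2).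
Proof.
split.
  rewrite /rho2; elim/big_ind: _ => [|x y Hx Hy|[i j] /= le_ij].
  - by exists 0%N, 0%N; split.
  - by case: (leP x y).
  - by exists i, j; split=> //; rewrite le_ij -ltnS ltn_ord.
move=> j1 j2 /andP[le12 le2].
have lt2 : (j2 < (2 * n).+1)%N by [].
have lt1 : (j1 < (2 * n).+1)%N by exact: leq_ltn_trans le12 lt2.
rewrite /rho2 (bigD1 (Ordinal lt1, Ordinal lt2)) //=.
by rewrite ge_min lexx.
Qed.

Fixpoint Q (i : nat) : {poly int} :=
  match i with
  | 0 => 1
  | i'.+1 => if i' is i''.+1 then Q i' - 'X * Q i'' else 1
  end.

Lemma Q0 : Q 0 = 1. Proof. by []. Qed.
Lemma Q1 : Q 1 = 1. Proof. by []. Qed.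
Lemma QSS (i : nat) : Q i.+2 = Q i.+1 - 'X * Q i. Proof. by []. Qed.

Lemma coef0_Q (i : nat) : (Q i)`_0 = 1.
Proof.
by case: i => [|i]; [rewrite coef1 | elim: i => [|i IH];
  rewrite ?coef1 // QSS coefB coefXM subr0].
Qed.

(* A formal power series is the sequence of its coefficients. *)
Definition fps (R : Type) := nat -> R.

Definition fps_coef (R : Type) (n : nat) (f : fps R) : R := f n.

Definition fps_poly (R : nzRingType) (p : {poly R}) : fps R := fun n => p`_n.

Definition fps_sub (R : nzRingType) (f g : fps R) : fps R := fun n => f n - g n.

Definition fps_mul (R : nzRingType) (f g : fps R) : fps R :=
  fun n => \sum_(i < n.+1) f i * g (n - i)%N.

(* The first [n] coefficients of 1/f, obtained by solving
   [\sum_(i <= m) f (m - i) * b i = (m == 0)] for [b m], [m = 0, 1, ...]. *)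
Fixpoint fps_inv_seq (R : unitRingType) (f : fps R) (n : nat) : seq R :=
  if n is m.+1 then
    let s := fps_inv_seq f m in
    rcons s ((f 0%N)^-1 * ((m == 0%N)%:R - \sum_(i < m) f (m - i)%N * s`_i))
  else [::].

Definition fps_inv (R : unitRingType) (f : fps R) : fps R :=
  fun n => (fps_inv_seq f n.+1)`_n.

Definition fps_div (R : unitRingType) (f g : fps R) : fps R :=
  fps_mul f (fps_inv g).

Lemma size_fps_inv_seq (R : unitRingType) (f : fps R) (n : nat) :
  size (fps_inv_seq f n) = n.
Proof. by elim: n => //= n IH; rewrite size_rcons IH. Qed.

Lemma nth_fps_inv_seq (R : unitRingType) (f : fps R) (n i : nat) :
  (i < n)%N -> (fps_inv_seq f n)`_i = fps_inv f i.
Proof.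
elim: n => // n IH; rewrite ltnS leq_eqVlt => /predU1P[-> // | lt_in].
by rewrite /= nth_rcons size_fps_inv_seq lt_in IH.
Qed.

Lemma fps_mulV (R : unitRingType) (f : fps R) (n : nat) :
  f 0%N \is a GRing.unit -> fps_mul f (fps_inv f) n = (n == 0%N)%:R.
Proof.
move=> f0U; rewrite /fps_mul big_ord_recl subn0.
rewrite {1}/fps_inv /= nth_rcons size_fps_inv_seq ltnn eqxx mulVKr //.
rewrite -[RHS](subrK (\sum_(i < n) f (n - i)%N * (fps_inv_seq f n)`_i)).
congr (_ + _); rewrite [RHS](reindex_inj rev_ord_inj) /=.
apply: eq_bigr => i _; have lt_in := ltn_ord i.
by rewrite nth_fps_inv_seq ?subKn ?rev_ord_proof.
Qed.

(* Main.v *)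
(* Read [g] as a closed walk W on the integers, with step +1 for the letter 0 and
   -1 for the letter 1.  Since min(a, b) = (a + b - |a - b|) / 2 and the three
   increments of W cut out by j1, j2 sum to zero, rhat g j1 j2 is 1 minus the
   largest of their absolute values divided by n; hence rho2 g = 1 - range(W)/n.
   A walk of range r fits into the path with m vertices from max(0, m - r)
   starting points, so, writing T_m for the number of closed walks of length 2n
   on that path, the walks of range at most k are T_(k+1) - T_k in number.
   The diagonal of the resolvent of the path gives
   T_m = [x^n] \sum_(i < m) Q_i Q_(m-1-i) / Q_m = - [x^n] Q'_(m+1) / Q_m. *)
Require Import Defs.
From HB Require Import structures.
From mathcomp Require Import all_boot all_order all_algebra.
From mathcomp Require Import zify ring lra.
Set Implicit Arguments.
Unset Strict Implicit.
Unset Printing Implicit Defensive.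
Import Order.TTheory GRing.Theory Num.Theory.
Local Open Scope ring_scope.

Local Arguments Q : simpl never.

(** * Formal power series and their quotients *)

Section PowerSeries.

Variable R : unitRingType.
Implicit Types f g h : fps R.

Lemma eq_fps_mul f f' g g' n :
  (forall i, (i <= n)%N -> f i = f' i) -> (forall i, (i <= n)%N -> g i = g' i) ->
  fps_mul f g n = fps_mul f' g' n.
Proof.
move=> eqf eqg; apply: eq_bigr => i _.
by rewrite eqf ?eqg ?leq_subr // -ltnS ltn_ord.
Qed.

Lemma fps_mul_polyE (p q : {poly R}) n :
  fps_mul (fps_poly p) (fps_poly q) n = (p * q)`_n.
Proof. by rewrite coefM. Qed.

(** Coefficients up to [n] only see truncations, so associativity is inherited from polynomials. *)
Lemma fps_mulA f g h n : fps_mul (fps_mul f g) h n = fps_mul f (fps_mul g h) n.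
Proof.
pose tr (f : fps R) := \poly_(i < n.+1) f i.
have trE f' i : (i <= n)%N -> f' i = fps_poly (tr f') i.
  by move=> le_in; rewrite /fps_poly coef_poly ltnS le_in.
have trM f' g' i : (i <= n)%N -> fps_mul f' g' i = fps_poly (tr f' * tr g') i.
  move=> le_in; rewrite -[RHS]fps_mul_polyE.
  by apply: eq_fps_mul => j le_ji; apply: trE; apply: leq_trans le_in.
rewrite (eq_fps_mul (trM f g) (trE h)) (eq_fps_mul (trE f) (trM g h)).
by rewrite !fps_mul_polyE mulrA.
Qed.

Lemma fps_divP f g h :
  g 0%N \is a GRing.unit -> (forall n, fps_mul f g n = h n) ->
  forall n, fps_div h g n = f n.
Proof.
move=> g0U fgh n; rewrite /fps_div.
rewrite (@eq_fps_mul _ (fps_mul f g) _ (fps_inv g)) //.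
rewrite fps_mulA /fps_mul big_ord_recr /= subnn.
rewrite [X in _ * X]fps_mulV // mulr1 big1 ?add0r // => i _.
by rewrite [X in _ * X]fps_mulV // subn_eq0 leqNgt ltn_ord mulr0.
Qed.

End PowerSeries.

Lemma sum_even_support (V : nmodType) (F : nat -> V) n :
  (forall i, odd i -> F i = 0) ->
  \sum_(i < (2 * n).+1) F i = \sum_(i < n.+1) F (2 * i)%N.
Proof.
move=> F0; elim: n => [|n IH]; first by rewrite !big_ord1.
rewrite big_ord_recr [RHS]big_ord_recr /= -IH mulnS add2n big_ord_recr /=.
by rewrite [F (2 * n).+1]F0 ?addr0 // oddS oddM.
Qed.

(** * Identities for the polynomials [Q] *)

(* The sequence [Q] shifted by one, with [Q (-1) = 0]: the recurrence then
   holds from the start and the resolvent below vanishes at both ends. *)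
Definition U (i : nat) : {poly int} := if i is i'.+1 then Q i' else 0.
Local Arguments U : simpl never.

Lemma USS i : U i.+2 = U i.+1 - 'X * U i.
Proof. by case: i => [|i] //; rewrite /U Q0 Q1 mulr0 subr0. Qed.

(** [Q m] sums (-x)^(number of edges) over the matchings of the path on [m] vertices. The two terms
    collect the matchings on [a + b] vertices that avoid, or use, the edge leaving the first [a]
    vertices. *)
Lemma U_add a b : U (a + b).+1 = U a.+1 * U b.+1 - 'X * U a * U b.
Proof.
elim: b a => [|b IH] a; first by rewrite addn0 [U 1]/U [U 0]/U Q0 mulr1 mulr0 subr0.
by rewrite addnS -addSn IH !USS; ring.
Qed.

(** Differentiating marks an edge of a matching; removing it with its ends leaves paths on [i] and
    [m - i.+1] vertices. *)
Lemma deriv_Q m : (Q m.+1)^`() = - \sum_(i < m) Q i * Q (m - i.+1).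
Proof.
have dQ i : (Q i.+2)^`() = (Q i.+1)^`() - Q i - 'X * (Q i)^`().
  by rewrite QSS derivB derivM derivX mul1r opprD addrA.
elim/ltn_ind: m => -[|[|m]] IH.
- by rewrite big_ord0 oppr0 derivC.
- by rewrite big_ord1 dQ !derivC; ring.
rewrite dQ !IH // !big_ord_recr /= subnn subSnn subnn.
(* The recurrence applies only to indices at least 2, hence the two terms split off. *)
have -> : \sum_(i < m) Q i * Q (m.+2 - i.+1) =
    \sum_(i < m) Q i * Q (m.+1 - i.+1) - 'X * \sum_(i < m) Q i * Q (m - i.+1).
  rewrite mulr_sumr -sumrB; apply: eq_bigr => i _.
  have -> : (m.+2 - i.+1 = (m - i.+1).+2)%N by have := ltn_ord i; lia.
  have -> : (m.+1 - i.+1 = (m - i.+1).+1)%N by have := ltn_ord i; lia.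
  by rewrite QSS; ring.
by rewrite Q0 Q1; ring.
Qed.

(** * Walks on a path and their Green function *)

(* The number of walks of length [l] from [i] to [j] on the path with vertices
   1, ..., m. *)
Fixpoint nwalk (m j l i : nat) : nat :=
  if (0 < i <= m)%N then
    if l is l'.+1 then (nwalk m j l' i.-1 + nwalk m j l' i.+1)%N
    else nat_of_bool (i == j)
  else 0%N.

(* Q_m(z^2) times the Green function from [i] to [j] of that path. *)
Definition green (m j i : nat) : {poly int} :=
  if (i <= j)%N then 'X^(j - i) * ((U i * U (m.+1 - j)) \Po 'X^2)
  else 'X^(i - j) * ((U j * U (m.+1 - i)) \Po 'X^2).

(** Off the diagonal this is the three-term recurrence of [U]; on it, [U_add] yields the source term
    [Q m]. *)
Lemma green_harmonic m j i : (0 < j <= m)%N -> (0 < i <= m)%N ->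
  green m j i = (Q m \Po 'X^2) *+ (i == j)
                + 'X * (green m j i.-1 + green m j i.+1).
Proof.
case: j => // j /= lt_jm; case: i => // i /= lt_im; rewrite /green !eqSS !ltnS.
have X2 : 'X \Po 'X^2 = 'X^2 :> {poly int} by rewrite comp_polyX.
have USc a : U a.+2 \Po 'X^2 = (U a.+1 \Po 'X^2) - 'X^2 * (U a \Po 'X^2).
  by rewrite USS comp_polyB comp_polyM X2.
case: (ltngtP i j) => [lt_ij|lt_ji|<-] /=.
- rewrite !ifT ?leqW 1?ltnW // mulr0n add0r.
  have [d ->] : exists d, j = (i + d).+1 by exists (j - i.+1)%N; lia.
  have -> : ((i + d).+2 - i.+1 = d.+1)%N by lia.
  have -> : ((i + d).+2 - i = d.+2)%N by lia.
  have -> : ((i + d).+2 - i.+2 = d)%N by lia.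
  by rewrite !comp_polyM USc !exprS; ring.
- rewrite mulr0n add0r.
  have [d Di] : exists d, i = (j + d).+1 by exists (i - j.+1)%N; lia.
  rewrite Di.
  have [e me] : exists e, m = ((j + d).+2 + e)%N by exists (m - (j + d).+2)%N; lia.
  have -> : ((j + d).+2 - j.+1 = d.+1)%N by lia.
  have -> : ((j + d).+3 - j.+1 = d.+2)%N by lia.
  have -> : (m.+1 - (j + d).+2 = e.+1)%N by lia.
  have -> : (m.+1 - (j + d).+3 = e)%N by lia.
  have -> : (m.+1 - (j + d).+1 = e.+2)%N by lia.
  case: leqP => [_|le].
    have -> : ((j + d).+1 - j.+1 = d)%N by lia.
    by rewrite !comp_polyM USc !exprS; ring.
  (* Right neighbour of the target: its predecessor is on the diagonal, in the other branch of
     [green]. *)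
  have -> : d = 0%N by lia.
  have -> : (m.+1 - j.+1 = e.+2)%N by lia.
  by rewrite addn0 subnn !comp_polyM USc; ring.
rewrite leqnSn subnn subSnn mulr1n.
have [e me] : exists e, m = (i.+1 + e)%N by exists (m - i.+1)%N; lia.
have -> : (m.+1 - i.+1 = e.+1)%N by lia.
have -> : (m.+1 - i.+2 = e)%N by lia.
have -> : (i.+2 - i.+1 = 1)%N by lia.
have -> : Q m = U i.+2 * U e.+1 - 'X * U i.+1 * U e by rewrite -U_add me.
by rewrite comp_polyB !comp_polyM X2 USc; ring.
Qed.

Lemma green_eq0 m j i : (0 < j <= m)%N -> ~~ (0 < i <= m)%N -> (i <= m.+1)%N ->
  green m j i = 0.
Proof.
move=> j_in; rewrite /green; case: i => [|i] /=.
  by rewrite mul0r comp_poly0 mulr0.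
rewrite -leqNgt => le_mi le_im; have -> : i = m by lia.
by rewrite subnn /= !mulr0 comp_poly0 mulr0 ifF //; lia.
Qed.

Lemma nwalk_out m j l i : ~~ (0 < i <= m)%N -> nwalk m j l i = 0%N.
Proof. by case: l => [|l] /= /negbTE ->. Qed.

(** Both sides obey the same first-step recursion in [l] and vanish at the ends 0 and [m.+1]. *)
Lemma nwalk_green m j l i : (0 < j <= m)%N -> (i <= m.+1)%N ->
  \sum_(s < l.+1) (nwalk m j (l - s) i)%:R * (Q m \Po 'X^2)`_s = (green m j i)`_l.
Proof.
move=> j_in; elim: l i => [|l IH] i le_im.
all: have [i_in|i_out] := boolP (0 < i <= m)%N; last first.
1,3: by rewrite (green_eq0 j_in) // coef0 big1 // => s _; rewrite nwalk_out ?mul0r.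
  rewrite big_ord1 (green_harmonic j_in i_in) coefD coefXM addr0 /= i_in.
  by rewrite coefMn mulr_natl.
rewrite (green_harmonic j_in i_in) coefD coefXM /= coefMn coefD.
rewrite -!IH; [|lia..].
(* The last summand, from walks of length 0, matches the source term. *)
rewrite big_ord_recr /= subnn /= i_in mulr_natl addrC -big_split /=.
congr (_ + _); apply: eq_bigr => s _.
by rewrite subSn -1?ltnS // /= i_in natrD mulrDl.
Qed.

Definition nclosed (m n : nat) : nat := \sum_(j < m) nwalk m j.+1 (2 * n) j.+1.

Lemma nclosed_fps m n :
  fps_div (fps_poly (Q m.+1)^`()) (fps_poly (Q m)) n = - (nclosed m n)%:R.
Proof.
apply: (@fps_divP _ (fun n => - (nclosed m n)%:R)) => {n}[|n].
  by rewrite /fps_poly coef0_Q unitr1.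
rewrite /fps_poly deriv_Q coefN coef_sum /fps_mul /nclosed.
under eq_bigr => s _ do rewrite mulNr natr_sum mulr_suml.
rewrite sumrN exchange_big; congr (- _); apply: eq_bigr => j _ /=.
have j_in : (0 < j.+1 <= m)%N by rewrite ltn_ord.
have := nwalk_green (2 * n) j_in (leqW (ltn_ord j)).
rewrite /green leqnn subnn mul1r subSS coef_comp_poly_Xn // dvdn_mulr // mulKn //.
have -> : (m - j)%N = (m - j.+1).+1 by have := ltn_ord j; lia.
move=> /= <-.
pose F s : int := (nwalk m j.+1 (2 * n - s) j.+1)%:R * (Q m \Po 'X^2)`_s.
rewrite (@sum_even_support _ F) => [|s odd_s]; last first.
  by rewrite /F coef_comp_poly_Xn // dvdn2 odd_s mulr0.
rewrite [RHS](reindex_inj rev_ord_inj); apply: eq_bigr => s _ /=.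
rewrite /F coef_comp_poly_Xn // dvdn_mulr // mulKn // subSS mulnBr subKn //.
by rewrite leq_mul2l -ltnS ltn_ord.
Qed.

(** * Closed walks counted by their range *)

Lemma big_tuple_cons (T : finType) (V : nmodType) l (F : l.+1.-tuple T -> V) :
  \sum_(t : l.+1.-tuple T) F t =
  \sum_(x : T) \sum_(t : l.-tuple T) F [tuple of x :: t].
Proof.
rewrite pair_bigA (reindex (fun p : T * l.-tuple T => [tuple of p.1 :: p.2])) //=.
exists (fun t => (thead t, [tuple of behead t])) => [[x t] _|t _].
  by congr (_, _); apply: val_inj.
by rewrite /= -tuple_eta.
Qed.

(* The walk with steps +1 ([false]) and -1 ([true]) stays in 1, ..., m. *)
Fixpoint strip (m i : nat) (s : seq bool) : bool :=
  (0 < i <= m)%N &&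
  (if s is b :: s' then strip m (if b then i.-1 else i.+1) s' else true).

Lemma nwalkE m j l i :
  nwalk m j l i = (\sum_(g : l.-tuple bool)
    (strip m i g && (i + count_mem false g == j + count_mem true g)%N))%N.
Proof.
elim: l i => [|l IH] i.
  rewrite (big_pred1 [tuple]) => [|g]; last exact/esym/eqP/tuple0.
  by rewrite /= !addn0 andbT; case: ifP.
rewrite big_tuple_cons big_bool /= !IH; case: ifP => /= [i_in|_].
  congr addn; apply: eq_bigr => g _ /=; congr (nat_of_bool (_ && _)); lia.
by rewrite !big1.
Qed.

(* The maximal height reached from 0; the truncated predecessor accounts for the
   starting height 0 itself. *)
Fixpoint peak (s : seq bool) : nat :=
  if s is b :: s' then if b then (peak s').-1 else (peak s').+1 else 0.

(** Swapping the letters reflects the walk, so this is its depth below 0. *)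
Definition trough (s : seq bool) : nat := peak (map negb s).

Lemma stripE m i s : strip m i s = (trough s < i)%N && (i + peak s <= m)%N.
Proof.
elim: s i => [|[] s IH] i; rewrite /= ?andbT ?addn0 // IH /trough /=; lia.
Qed.

Lemma count_mem_negb b (s : seq bool) : count_mem b (map negb s) = count_mem (~~ b) s.
Proof. by rewrite count_map; apply: eq_count => -[]; case: b. Qed.

Lemma peak_ub (s : seq bool) t :
  (count_mem false (take t s) <= peak s + count_mem true (take t s))%N.
Proof.
elim: s t => [|[] s IH] [|t] //=; have /= := IH t; lia.
Qed.

Lemma peak_attained (s : seq bool) : exists2 t, (t <= size s)%N &
  count_mem false (take t s) = (peak s + count_mem true (take t s))%N.
Proof.
elim: s => [|[] s [t le_ts Et]]; first by exists 0%N.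
  have [c0|c_gt0] := posnP (peak s); first by exists 0%N; rewrite //= c0.
  by exists t.+1; move: Et => //= ->; lia.
by exists t.+1; move: Et => //= ->; lia.
Qed.

Lemma trough_ub (s : seq bool) t :
  (count_mem true (take t s) <= trough s + count_mem false (take t s))%N.
Proof. by have := peak_ub (map negb s) t; rewrite -map_take !count_mem_negb. Qed.

Lemma trough_attained (s : seq bool) : exists2 t, (t <= size s)%N &
  count_mem true (take t s) = (trough s + count_mem false (take t s))%N.
Proof.
have [t] := peak_attained (map negb s).
by rewrite size_map -map_take !count_mem_negb; exists t.
Qed.

Lemma count_interval a c m : (\sum_(j < m) (a <= j < c) = minn m c - a)%N.
Proof.
elim: m => [|m IH]; first by rewrite big_ord0; lia.
by rewrite big_ord_recr /= IH; lia.
Qed.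

Lemma in_Gamma n (g : (2 * n).-tuple bool) :
  (g \in Gamma n) = (count_mem false g == count_mem true g).
Proof.
have : (count_mem false g + count_mem true g = 2 * n)%N.
  rewrite -[RHS](size_tuple g) -(count_predC (pred1 false)).
  by congr addn; apply: eq_count => -[].
by rewrite inE; lia.
Qed.

(** Truncated subtraction counts the starting points that keep the walk in the strip. *)
Lemma nclosedE m n :
  nclosed m n = (\sum_(g in Gamma n) (m - (trough g + peak g)))%N.
Proof.
rewrite /nclosed; rewrite (eq_bigr _ (fun j _ => nwalkE _ _ _ _)).
rewrite exchange_big [RHS]big_mkcond; apply: eq_bigr => g _ /=.
rewrite in_Gamma; case: ifP => [cft|ncft].
  under eq_bigr => j _.
    rewrite stripE eqn_add2l cft andbT.
    have -> : ((trough g < j.+1) && (j.+1 + peak g <= m))%N =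
              (trough g <= j < m - peak g)%N by lia.
    over.
  by rewrite count_interval (minn_idPr (leq_subr _ _)) -subnDA addnC.
by rewrite big1 // => j _; rewrite eqn_add2l ncft andbF.
Qed.

(** For a walk of range r, [k.+1 - r] exceeds [k - r] by 1 if r is at most [k], and by 0
    otherwise. *)
Lemma card_peak_trough n k :
  (#|[set g in Gamma n | trough g + peak g <= k]| + nclosed k n = nclosed k.+1 n)%N.
Proof.
rewrite !nclosedE -sum1_card.
rewrite (eq_bigl (fun g => (g \in Gamma n) && (trough g + peak g <= k)%N)); last first.
  by move=> g; rewrite !inE.
rewrite big_mkcondr -big_split; apply: eq_bigr => g _ /=.
by case: leqP; lia.
Qed.

(** * From [rho2] to the range of the walk *)

Lemma rhatE n (g : (2 * n).-tuple bool) i j : (0 < n)%N -> g \in Gamma n ->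
  let F := Fhat false g in let T := Fhat true g in
  rhat g i j = Num.min (F i) (T i) + Num.min (F j - F i) (T j - T i)
               + Num.min (1 - F j) (1 - T j).
Proof.
move=> n_gt0; rewrite inE => /andP[/eqP cf /eqP ct] F T.
have nn : n%:R / n%:R = 1 :> rat by rewrite divff // pnatr_eq0 -lt0n.
have Fhat0 b : Fhat b g 0 = 0 by rewrite /Fhat take0 mul0r.
have Fhat1 b : Fhat b g (2 * n) = 1.
  by rewrite /Fhat take_oversize ?size_tuple //; case: b; rewrite ?cf ?ct.
rewrite /rhat !big_ord_recr big_ord0 /= /increment add0r.
by rewrite !Fhat0 !Fhat1 !subr0.
Qed.

Lemma rho2_ge n (g : (2 * n).-tuple bool) k : (0 < n)%N -> g \in Gamma n ->
  (1 - k%:R / n%:R <= rho2 g) = (trough g + peak g <= k)%N.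
Proof.
move=> n_gt0 gG; have n0 : (0 < n%:R^-1 :> rat) by rewrite invr_gt0 ltr0n.
have le_div (a b : nat) : (a%:R / n%:R <= b%:R / n%:R :> rat) = (a <= b)%N.
  by rewrite ler_pM2r // ler_nat.
pose D t := Fhat false g t - Fhat true g t.
have D_le t : D t <= (peak g)%:R / n%:R.
  by rewrite lerBlDr -mulrDl -natrD le_div peak_ub.
have D_ge t : - D t <= (trough g)%:R / n%:R.
  by rewrite opprB lerBlDr -mulrDl -natrD le_div trough_ub.
have [rho2_attained rho2_min] := rho2P g.
rewrite -le_div natrD mulrDl; apply/idP/idP => [rho_ge|le_k].
  (* Cutting at a highest and a lowest point, in order of time, and bounding each minimum by the
     suitable letter gives 1 - range/n. *)
  have [t1 le_t1 Et1] := peak_attained g; have [t2 le_t2 Et2] := trough_attained g.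
  have D1 : D t1 = (peak g)%:R / n%:R.
    by rewrite /D /Fhat Et1 natrD mulrDl addrK.
  have D2 : - D t2 = (trough g)%:R / n%:R.
    by rewrite /D /Fhat Et2 natrD mulrDl opprB addrK.
  rewrite size_tuple in le_t1 le_t2.
  have minl (x y : rat) : Num.min x y <= x by rewrite ge_min lexx.
  have minr (x y : rat) : Num.min x y <= y by rewrite ge_min lexx orbT.
  have [le12|/ltnW le21] := leqP t1 t2.
    have := rho2_min t1 t2; rewrite le12 le_t2 rhatE // => /(_ isT).
    have := minr (Fhat false g t1) (Fhat true g t1).
    have := minl (Fhat false g t2 - Fhat false g t1) (Fhat true g t2 - Fhat true g t1).
    have := minr (1 - Fhat false g t2) (1 - Fhat true g t2).
    move: D1 D2 rho_ge; rewrite /D; lra.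
  have := rho2_min t2 t1; rewrite le21 le_t1 rhatE // => /(_ isT).
  have := minl (Fhat false g t2) (Fhat true g t2).
  have := minr (Fhat false g t1 - Fhat false g t2) (Fhat true g t1 - Fhat true g t2).
  have := minl (1 - Fhat false g t1) (1 - Fhat true g t1).
  move: D1 D2 rho_ge; rewrite /D; lra.
have [i [j [_ ->]]] := rho2_attained; rewrite rhatE //.
have D0 : D 0%N = 0 by rewrite /D /Fhat take0 subrr.
(* Every choice of letters in the three minima gives 1 plus a difference of two values of [D] at 0,
   [i], [j]. *)
have := (D_le 0%N, D_ge 0%N, D_le i, D_le j, D_ge i, D_ge j).
rewrite D0 /D; move: (Fhat _ g i) (Fhat _ g j) (Fhat _ g i) (Fhat _ g j).
by move=> ? ? ? ? [[[[[? ?] ?] ?] ?] ?]; do 3![rewrite minElt; case: ifP => _]; lra.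
Qed.

Theorem theorem3p9 (n : nat) (hn : (0 < n)%N) (k : nat) (hk : (k <= n)%N) :
  #|[set g in Gamma n | 1 - k%:R / n%:R <= rho2 g]|%:Z =
  fps_coef n
    (fps_sub (fps_div (fps_poly (Q k.+1)^`()) (fps_poly (Q k)))
             (fps_div (fps_poly (Q k.+2)^`()) (fps_poly (Q k.+1)))).
Proof.
rewrite /fps_coef /fps_sub !nclosed_fps -card_peak_trough.
have -> : [set g in Gamma n | 1 - k%:R / n%:R <= rho2 g] =
          [set g in Gamma n | trough g + peak g <= k]%N.
  apply/setP => g; rewrite !inE; apply: andb_id2l => gG.
  by rewrite rho2_ge // inE.
by rewrite opprK addrC natrD addrK natz.
Qed.
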